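(* Let $D \subset \mathbb{Z}^m \setminus \{\mathbf{0}\}$ be a finite set with $D = -D$. Then for every non-zero Laurent polynomial \[ f(z_1, \ldots, z_m) = \sum_{d \in D} c_d z_1^{d_1}\cdots z_m^{d_m} \quad \text{with } c_{-d} = \overline{c_d} \text{ for all } d \in D, \] we have $\alpha(D) \leq \min(\rho_+(f), \rho_-(f))$; that is, $\alpha(D) \leq \rho(D)$.
   Context: Such $f$ is real-valued on $\mathbb{T}^m$, $\mathbb{T}$ the unit circle. $\lambda_m$ is the normalized Lebesgue (Haar) measure on $\mathbb{T}^m$ with $\lambda_m(\mathbb{T}^m) = 1$; $\rho_+(f) = \lambda_m(\{z \in \mathbb{T}^m : f(z) > 0\})$ and $\rho_-(f) = \lambda_m(\{z \in \mathbb{T}^m : f(z) < 0\})$. $\rho(D)$ is the least value of $\min(\rho_+(f), \rho_-(f))$ over all such non-zero $f$. The $m$-circulant graph $G_n$ with set of differences $D$ has vertex set $\{0, \ldots, n-1\}^m$, vertices $u, v$ (possibly equal) being adjacent iff $u - v$ is congruent coordinatewise modulo $n$ to some $d \in D$. $\alpha(G)$ is the maximum size of an independent set (no two adjacent vertices, no looped vertex), and $\alpha(D) := \lim_{n \to \infty} \alpha(G_n)/n^m$ (this limit exists). *)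

(* Defs.v *)
From HB Require Import structures.
From mathcomp Require Import all_boot all_order all_algebra finmap.
From mathcomp Require Import all_classical all_reals all_analysis.
From mathcomp Require Import complex.

Set Implicit Arguments.
Unset Strict Implicit.
Unset Printing Implicit Defensive.

Import Order.TTheory GRing.Theory Num.Theory.
Import numFieldNormedType.Exports.

Local Open Scope classical_set_scope.
Local Open Scope ring_scope.

Definition zvec0 (m : nat) : m.-tuple int := nseq_tuple m 0.
Definition zvecN (m : nat) (d : m.-tuple int) : m.-tuple int :=
  map_tuple (fun x => - x) d.

Definition circ_adj (m n : nat) (D : {fset m.-tuple int})
    (u v : m.-tuple 'I_n) : bool :=
  has (fun d : m.-tuple int =>
         [forall i : 'I_m,
            (n%:Z %| (nat_of_ord (tnth u i))%:Z - (nat_of_ord (tnth v i))%:Z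
                      - tnth d i)%Z])
      D.

Definition circ_indep (m n : nat) (D : {fset m.-tuple int})
    (S : {set m.-tuple 'I_n}) : bool :=
  [forall u in S, forall v in S, ~~ circ_adj D u v].

Definition alpha_circ (m n : nat) (D : {fset m.-tuple int}) : nat :=
  \max_(S : {set m.-tuple 'I_n} | circ_indep D S) #|S|.

Definition alphaD (R : realType) (m : nat) (D : {fset m.-tuple int}) : R :=
  limn (fun n : nat => (alpha_circ n D)%:R / (n%:R ^+ m) : R).

(* The torus T^m with normalized Haar measure lambda_m, parametrised   *)
(* by angles t in [0,1]^m, z_j = exp(2 pi i t_j). lambda_m(A) is the   *)
(* m-fold iterated Lebesgue integral over [0,1]^m of the indicator of  *)
(* the preimage of A (this is the m-fold product of Lebesgue measure   *)
(* on [0,1]).                                                          *)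

Fixpoint cube_int (R : realType) (m : nat) :
    (m.-tuple R -> \bar R) -> \bar R :=
  match m with
  | 0 => fun g => g [tuple]
  | m'.+1 => fun g =>
      (\int[@lebesgue_measure R]_(x in `[0%R, 1%R])
          cube_int (fun t : m'.-tuple R => g [tuple of x :: t]))%E
  end.

Definition circ_pt (R : realType) (x : R) : R[i] :=
  (cos (2 * pi * x) +i* sin (2 * pi * x))%C.

Definition torus_pt (R : realType) (m : nat) (t : m.-tuple R) :
  m.-tuple R[i] := map_tuple (@circ_pt R) t.

Definition haar_torus (R : realType) (m : nat) (A : set (m.-tuple R[i]))
  : \bar R :=
  cube_int (fun t : m.-tuple R => ((\1_A (torus_pt t) : R)%:E)).

Definition laurent (R : realType) (m : nat) (D : {fset m.-tuple int})
    (c : m.-tuple int -> R[i]) (z : m.-tuple R[i]) : R[i] :=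
  \sum_(d <- D) c d * \prod_(i < m) (tnth z i) ^ (tnth d i).

Definition torus (R : realType) (m : nat) : set (m.-tuple R[i]) :=
  [set z | forall i : 'I_m, `|tnth z i| = 1].

(* rho_+(f), rho_-(f) ; f is real-valued on T^m, and the order on R[i]  *)
(* is the one for which 0 < w iff w is a positive real.                *)
Definition rho_plus (R : realType) (m : nat) (f : m.-tuple R[i] -> R[i])
  : \bar R := haar_torus [set z | torus z /\ 0 < f z].
Definition rho_minus (R : realType) (m : nat) (f : m.-tuple R[i] -> R[i])
  : \bar R := haar_torus [set z | torus z /\ f z < 0].

(* Main.v *)
(* An independent set S of G_n supports a subspace of dimension |S| on which the
   quadratic form of the circulant matrix with entries c_(u-v) vanishes. The
   Fourier basis diagonalises this form, so |S| is at most the number of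
   eigenvalues that are not negative. Twisting c_d by w^d for w on the torus
   keeps the support, and turns the eigenvalues into the values of f at the
   points w * zeta^k, where zeta = exp(2 pi i / n) and k ranges over
   {0, ..., n-1}^m. Averaging over w gives, for every n > 0,
   alpha(G_n) / n^m <= lambda_m(f >= 0), which is rho_+(f) because the zero set
   of a non-zero Laurent polynomial is a null set. Applying this to -f bounds
   alpha(D) by rho_-(f). *)

Require Import Defs.
From HB Require Import structures.
From mathcomp Require Import all_boot all_order all_algebra finmap.
From mathcomp Require Import all_classical all_reals all_analysis.
From mathcomp Require Import measurable_realfun complex ring lra.

Set Implicit Arguments.
Unset Strict Implicit.
Unset Printing Implicit Defensive.

Import Order.TTheory GRing.Theory Num.Theory.
Import numFieldNormedType.Exports.
Local Open Scope ring_scope.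

(** * The parametrisation of the circle *)

Section CircPt.
Variable R : realType.
Implicit Types x y : R.

Lemma circ_pt0 : circ_pt (0 : R) = 1.
Proof. by rewrite /circ_pt mulr0 cos0 sin0. Qed.

Lemma circ_ptD x y : circ_pt (x + y) = circ_pt x * circ_pt y.
Proof.
rewrite /circ_pt mulrDr cosD sinD /GRing.mul /=; congr (_ +i* _)%C.
by rewrite addrC.
Qed.

Lemma circ_ptN_mul x : circ_pt (- x) * circ_pt x = 1.
Proof. by rewrite -circ_ptD addNr circ_pt0. Qed.

Lemma circ_pt_neq0 x : circ_pt x != 0.
Proof.
apply/eqP => x0; have := circ_ptN_mul x.
by rewrite x0 mulr0 => /esym/eqP; rewrite oner_eq0.
Qed.

Lemma circ_ptN x : circ_pt (- x) = (circ_pt x)^-1.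
Proof.
by apply: (mulIf (circ_pt_neq0 x)); rewrite circ_ptN_mul mulVf // circ_pt_neq0.
Qed.

Lemma conj_circ_pt x : (circ_pt x)^* = circ_pt (- x).
Proof. by rewrite /circ_pt mulrN cosN sinN. Qed.

Lemma normr_circ_pt x : `|circ_pt x| = 1.
Proof.
rewrite normc_def /= cos2Dsin2 sqrtr1; exact: (rmorph1 (real_complex R)).
Qed.

Lemma circ_ptMn x n : circ_pt (x * n%:R) = circ_pt x ^+ n.
Proof.
elim: n => [|n IH]; first by rewrite mulr0 circ_pt0 expr0.
by rewrite -addn1 natrD mulrDr mulr1 circ_ptD IH addn1 exprSr.
Qed.

Lemma circ_ptMz x (k : int) : circ_pt (x * k%:~R) = circ_pt x ^ k.
Proof.
case: (intP k) => [|n|n]; first by rewrite mulr0 circ_pt0 expr0z.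
- by rewrite -pmulrn circ_ptMn.
- by rewrite mulrNz mulrN circ_ptN -pmulrn circ_ptMn exprnN.
Qed.

Lemma circ_pt1 : circ_pt (1 : R) = 1.
Proof. by rewrite /circ_pt mulr1 mulrC mulr_natr cos2pi sin2pi. Qed.

Lemma circ_ptz (k : int) : circ_pt (k%:~R : R) = 1.
Proof. by rewrite -[k%:~R]mul1r circ_ptMz circ_pt1 exp1rz. Qed.

(** The real part is 1 - 2 sin(pi x)^2, and sin(pi x) > 0 on the open interval. *)
Lemma circ_pt_neq1 x : 0 < x < 1 -> circ_pt x != 1.
Proof.
move=> /andP[x0 x1]; apply/eqP => /(congr1 (@complex.Re R)) /=.
have s0 : 0 < sin (pi * x).
  apply: sin_gt0_pi; rewrite mulr_gt0 ?pi_gt0 //=.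
  by rewrite -[ltRHS]mulr1 ltr_pM2l // pi_gt0.
rewrite -mulrA mulr_natl cos_mulr2n cos2sin2 => /eqP.
rewrite -subr_eq0 => /eqP h.
have : 0 < sin (pi * x) ^+ 2 by rewrite exprn_gt0.
by lra.
Qed.

Lemma circ_pt_inj : {in `[0, 1[ &, injective (@circ_pt R)}.
Proof.
move=> x y; rewrite !in_itv /= => xI yI exy.
wlog lexy : x y xI yI exy / x <= y.
  by move=> h; case/orP: (le_total x y) => ?; [|symmetry]; apply: h.
apply/eqP; rewrite eq_le lexy /= leNgt; apply/negP => ltxy.
have : circ_pt (y - x) != 1 by apply: circ_pt_neq1; lra.
by rewrite circ_ptD circ_ptN exy mulfV ?circ_pt_neq0 // eqxx.
Qed.

(** [q] splits over the algebraically closed field [R[i]], so it has finitely many roots, and each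
    has at most one angle in [0, 1[. The endpoint 1, which has the same image as 0, is set apart. *)
Lemma finite_circ_pt_root (q : {poly R[i]}) : q != 0 ->
  finite_set [set x : R | 0 <= x <= 1 /\ root q (circ_pt x)]%classic.
Proof.
move=> q0; have [rs defq] := closed_field_poly_normal q.
have sub : ([set x : R | 0 <= x <= 1 /\ root q (circ_pt x)] `<=`
   [set 1] `|` [set x : R | (0 <= x < 1) /\ circ_pt x \in rs])%classic.
  move=> x [/andP[x0 x1]].
  rewrite defq rootZ ?lead_coef_eq0 // root_prod_XsubC => xr.
  have [->|xn1] := eqVneq x 1; [by left|right].
  by split=> //=; rewrite x0 lt_neqAle xn1.
apply: (sub_finite_set sub); rewrite finite_setU; split; first exact: finite_set1.
(* A partial inverse of [circ_pt]: by injectivity, the remaining angles lie in the image under [g]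
   of the finite list [rs]. *)
pose g z := xget 0 [set y : R | (0 <= y < 1) /\ circ_pt y = z]%classic.
apply: (@sub_finite_set _ _ (g @` [set z | z \in rs])%classic); last first.
  exact/finite_image/finite_seq.
move=> x [xI xrs]; exists (circ_pt x) => //.
rewrite /g; case: xgetP => [y -> [yI eyx]|/(_ x) []//].
by apply: circ_pt_inj; rewrite ?in_itv.
Qed.

End CircPt.

(** * The inertia bound *)

(** Restricted to [S] and [B], [M] is a matrix with more rows than columns, so its left kernel is
    not zero. *)
Lemma exists_kernel_vector (F : fieldType) (T1 T2 : finType) (S : {set T1})
    (B : {set T2}) (M : T1 -> T2 -> F) : (#|B| < #|S|)%N ->
  exists x : T1 -> F, [/\ forall u, u \notin S -> x u = 0,
    exists u, x u != 0 & forall k, k \in B -> \sum_u x u * M u k = 0].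
Proof.
move=> ltBS; pose A : 'M[F]_(#|S|, #|B|) :=
  \matrix_(a, b) M (enum_val a) (enum_val b).
have : kermx A != 0.
  by rewrite kermx_eq0 /row_free neq_ltn (leq_ltn_trans (rank_leq_col A)).
move=> /rowV0Pn[v /sub_kermxP vA /rV0Pn[a0 va0]].
(* The sum has at most one term; it extends the kernel vector by zero outside [S]. *)
pose x u := \sum_(a | enum_val a == u) v 0 a.
have xE a : x (enum_val a) = v 0 a.
  rewrite /x (big_pred1 a) // => b /=; exact/inj_eq/enum_val_inj.
exists x; split.
- move=> u uS; rewrite /x big_pred0 // => a; apply/negP => /eqP eu.
  by move: uS; rewrite -eu enum_valP.
- by exists (enum_val a0); rewrite xE.
- move=> k kB; transitivity ((v *m A) 0 (enum_rank_in kB k)); last first.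
    by rewrite vA mxE.
  rewrite (bigID (mem S)) /= [X in _ + X]big1 ?addr0; last first.
    move=> u uS; rewrite /x big_pred0 ?mul0r // => a; apply/negP => /eqP eu.
    by move: uS; rewrite -eu enum_valP.
  rewrite big_enum_val mxE; apply: eq_bigr => a _.
  by rewrite xE mxE enum_rankK_in.
Qed.

(** * Characters of (Z/n)^m and the inertia bound for circulant graphs *)

Section Characters.
Variables (R : realType) (m n : nat).
Hypothesis n_gt0 : (0 < n)%N.
Implicit Types (a b : 'I_m -> int) (k u v : m.-tuple 'I_n).

(** The character exp(2 pi i <a, k> / n). The integer exponents [a] are not reduced modulo n, so
    that differences of vertices and elements of [D] can be added freely. *)
Definition zchar a k : R[i] :=
  \prod_(i < m) circ_pt ((a i)%:~R * (tnth k i)%:R / n%:R).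

Lemma zcharD a b k : zchar (fun i => a i + b i) k = zchar a k * zchar b k.
Proof.
rewrite /zchar -big_split; apply: eq_bigr => i _ /=.
by rewrite -circ_ptD intrD !mulrDl.
Qed.

Lemma conj_zchar a k : (zchar a k)^* = zchar (fun i => - a i) k.
Proof.
rewrite /zchar rmorph_prod; apply: eq_bigr => i _ /=.
by rewrite conj_circ_pt mulrNz !mulNr.
Qed.

Lemma sum_circ_pt (x : int) : \sum_(j < n) circ_pt (x%:~R * j%:R / n%:R : R) =
  if (n%:Z %| x)%Z then n%:R else 0.
Proof.
have nR : (n%:R : R) != 0 by rewrite pnatr_eq0 -lt0n.
under eq_bigr do rewrite mulrAC circ_ptMn.
case: ifPn => [/dvdzP[q ->]|ndvd].
  rewrite intrM -pmulrn mulfK // circ_ptz.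
  by under eq_bigr do rewrite expr1n; rewrite sumr_const card_ord.
set z := circ_pt _; have zn : z ^+ n = 1.
  by rewrite -circ_ptMn divfK // circ_ptz.
have z1 : z != 1.
  (* Reducing [x] modulo n brings the angle into ]0, 1[, where [circ_pt_neq1] applies. *)
  have xE : z = circ_pt ((x %% n%:Z)%Z%:~R / n%:R).
    rewrite /z {1}(divz_eq x n%:Z) intrD intrM -pmulrn mulrDl mulfK //.
    by rewrite circ_ptD circ_ptz mul1r.
  have n0 : n%:Z != 0 by rewrite eqz_nat -lt0n.
  rewrite xE circ_pt_neq1 // ltr_pdivrMr ?ltr0n // mul1r.
  rewrite divr_gt0 ?ltr0n ?ltr0z //=.
    by rewrite pmulrn ltr_int ltz_mod.
  by rewrite lt_neqAle modz_ge0 // andbT eq_sym; apply: contra ndvd => /eqP/dvdz_mod0P.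
have /eqP : (z - 1) * \sum_(j < n) z ^+ j = 0 by rewrite -subrX1 zn subrr.
by rewrite mulf_eq0 subr_eq0 (negPf z1) => /eqP.
Qed.

(** Orthogonality of characters: the sum over tuples factors into m geometric sums, and one
    vanishing factor suffices. *)
Lemma sum_zchar a : \sum_k zchar a k =
  if [forall i, (n%:Z %| a i)%Z] then n%:R ^+ m else 0.
Proof.
transitivity (\prod_(i < m) \sum_(j < n) circ_pt ((a i)%:~R * j%:R / n%:R : R)).
  rewrite bigA_distr_bigA.
  rewrite (reindex (fun f : {ffun 'I_m -> 'I_n} => [tuple f i | i < m])) /=.
    apply: eq_bigr => f _; apply: eq_bigr => i _; by rewrite tnth_mktuple.
  exists (fun t => [ffun i => tnth t i]) => [f _|t _].
    by apply/ffunP => i; rewrite ffunE tnth_mktuple.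
  by apply: eq_from_tnth => i; rewrite tnth_mktuple ffunE.
under eq_bigr do rewrite sum_circ_pt.
case: ifPn => [/forallP h|].
  by under eq_bigr do rewrite h; rewrite prodr_const card_ord.
rewrite negb_forall => /existsP[i /negPf hi].
by rewrite (bigD1 i) //= hi mul0r.
Qed.

Definition node (t : m.-tuple R) k : m.-tuple R :=
  [tuple tnth t i + (tnth k i)%:R / n%:R | i < m].

(** The translation by [t] only multiplies the coefficients by w^d and leaves the support [D] alone,
    so the values at the nodes are the eigenvalues of a circulant matrix with the same zero
    pattern. *)
Lemma laurent_node (D : {fset m.-tuple int}) (c : m.-tuple int -> R[i]) t k :
  laurent D c (torus_pt (node t k)) =
  \sum_(d <- D) (c d * \prod_(i < m) circ_pt (tnth t i) ^ tnth d i)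
     * zchar (tnth d) k.
Proof.
apply: eq_bigr => d _; rewrite -mulrA; congr (_ * _).
rewrite -big_split; apply: eq_bigr => i _ /=.
rewrite !tnth_map tnth_ord_tuple -!circ_ptMz -circ_ptD mulrDl.
by congr (circ_pt (_ + _)); rewrite mulrC mulrA.
Qed.

(* Cvetkovic's inertia bound. A vector x supported on S whose Fourier transform
   X vanishes at the nodes with f >= 0 satisfies 0 = sum_k f_k |X_k|^2, a sum of
   non-positive terms, so X = 0. *)
Lemma indep_inertia (D : {fset m.-tuple int}) (c : m.-tuple int -> R[i])
    (t : m.-tuple R) (S : {set m.-tuple 'I_n}) : circ_indep D S ->
  (#|S| <= #|[set k | ~~ (laurent D c (torus_pt (node t k)) < 0)%R]|)%N.
Proof.
move=> indS; rewrite leqNgt; apply/negP => ltBS.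
pose ch (u k : m.-tuple 'I_n) := zchar (fun i => (tnth u i)%:Z) k.
have [x [xS [u0 xu0] xB]] := exists_kernel_vector ch ltBS.
pose X k := \sum_u x u * ch u k; pose f k := laurent D c (torus_pt (node t k)).
have form0 : \sum_k f k * (X k * (X k)^*) = 0.
  pose w d := c d * \prod_(i < m) circ_pt (tnth t i) ^ tnth d i.
  transitivity (\sum_k \sum_(d <- D) \sum_u \sum_v w d * (x u * (x v)^*)
    * zchar (fun i => tnth d i + (tnth u i)%:Z - (tnth v i)%:Z) k).
    apply: eq_bigr => k _; rewrite /f laurent_node mulr_suml.
    apply: eq_bigr => d _; rewrite /X rmorph_sum big_distrlr /= mulr_sumr.
    apply: eq_bigr => u _; rewrite mulr_sumr; apply: eq_bigr => v _.
    rewrite zcharD zcharD -conj_zchar rmorphM /= -/(w d) /ch.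
    by ring.
  rewrite exchange_big big_seq big1 //= => d dD.
  rewrite exchange_big big1 //= => u _; rewrite exchange_big big1 //= => v _.
  (* A term survives the sum over k only if d + u - v is 0 modulo n. Then v and u are adjacent, so
     they cannot both lie in [S], and [x] vanishes at one of them. *)
  rewrite -mulr_sumr sum_zchar; case: ifPn; rewrite ?mulr0 // => /forallP h.
  have [uS|/xS->] := boolP (u \in S); last by rewrite mul0r mulr0 mul0r.
  have [vS|/xS->] := boolP (v \in S); last by rewrite conjC0 !mulr0 mul0r.
  have /forallP/(_ v)/implyP/(_ vS)/forallP/(_ u)/implyP/(_ uS) := indS.
  rewrite /circ_adj => /hasPn/(_ d dD)/negP[]; apply/forallP => i.
  have := h i; have -> : tnth d i + (tnth u i)%:Z - (tnth v i)%:Z =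
    - ((tnth v i)%:Z - (tnth u i)%:Z - tnth d i) by ring.
  by rewrite rpredN.
have X0 k : X k = 0.
  have le0 j : f j * (X j * (X j)^*) <= 0.
    have [fj|fj] := boolP (f j < 0).
      by rewrite nmulr_rle0 // mul_conjC_ge0.
    by rewrite /X xB ?mul0r ?mulr0 // inE.
  have /eqP := form0; rewrite -oppr_eq0 -sumrN psumr_eq0; last first.
    by move=> j _; rewrite oppr_ge0.
  move=> /allP/(_ k); rewrite mem_index_enum => /(_ isT).
  rewrite oppr_eq0 mulf_eq0 mul_conjC_eq0 => /orP[/eqP fk|/eqP//].
  (* Where f vanishes the form says nothing about [X k], but such nodes belong to the set on which
     [X] was chosen to vanish. *)
  by apply: xB; rewrite inE -/(f k) fk ltxx.
(* Fourier inversion at [u0]: as [X] = 0, it forces [x u0] = 0, a contradiction. *)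
have : \sum_k X k * zchar (fun i => - (tnth u0 i)%:Z) k = x u0 * n%:R ^+ m.
  under eq_bigr do rewrite mulr_suml.
  rewrite exchange_big (bigD1 u0) //= [X in _ + X]big1 ?addr0.
    under eq_bigr do rewrite -mulrA -zcharD.
    rewrite -mulr_sumr sum_zchar; case: ifPn => //; rewrite negb_forall => /existsP[j].
    by rewrite subrr dvdz0.
  move=> u uu0; under eq_bigr do rewrite -mulrA -zcharD.
  rewrite -mulr_sumr sum_zchar; case: ifPn; rewrite ?mulr0 // => /forallP h.
  case/negP: uu0; apply/eqP/eq_from_tnth => i; apply: val_inj => /=.
  have := h i; rewrite -eqz_mod_dvd !modz_nat eqz_nat.
  by rewrite !modn_small // => /eqP.
rewrite big1 => [/esym/eqP|k _]; last by rewrite X0 mul0r.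
by rewrite mulf_eq0 (negPf xu0) expf_eq0 pnatr_eq0 eqn0Ngt n_gt0 andbF.
Qed.

End Characters.

(** * Iterated integrals over the cube *)

Section LebesgueShift.
Variable R : realType.
Local Notation mu := (@lebesgue_measure R).
Local Open Scope classical_set_scope.
Local Open Scope ereal_scope.

Lemma measurable_fun_shift (s : R) :
  measurable_fun [set: R] (fun x : R => (x + s)%R).
Proof. exact: measurable_funD. Qed.

(** The pushforward agrees with Lebesgue measure on the intervals ]a, b], which determine the
    measure. *)
Lemma lebesgue_measure_shift (s : R) (A : set (measurableTypeR R)) : measurable A ->
  mu A = pushforward mu (fun x : measurableTypeR R => (x + s)%R : measurableTypeR R) A.
Proof.
have ms : measurable_fun [set: measurableTypeR R]
    (fun x : measurableTypeR R => (x + s)%R : measurableTypeR R).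
  exact: measurable_fun_shift.
pose nu := @measure_function_pushforward__canonical__measure_function_Measure
  _ _ (measurableTypeR R) (measurableTypeR R) R mu _ ms.
apply: (@lebesgue_measure_unique R nu) => _ [[a b] _ <-] /=.
rewrite /pushforward [X in _ = mu X](_ : _ = `](a - s)%R, (b - s)%R]).
  rewrite !lebesgue_measure_itv /= !lte_fin ltrD2r -!EFinB; case: ifP => // _.
  by congr (_%:E); ring.
apply/seteqP; split => x; rewrite /= !in_itv /=; lra.
Qed.

Lemma integral_shift (s : R) (g : R -> \bar R) (D : set R) : measurable D ->
  measurable_fun setT g -> (forall x, 0 <= g x) ->
  \int[mu]_(x in (fun x => x + s)%R @^-1` D) g (x + s)%R = \int[mu]_(x in D) g x.
Proof.
move=> mD mg g0.
have ms : measurable_fun [set: measurableTypeR R]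
    (fun x : measurableTypeR R => (x + s)%R : measurableTypeR R).
  exact: measurable_fun_shift.
rewrite -(ge0_integral_pushforward
  (phi := fun x : measurableTypeR R => (x + s)%R : measurableTypeR R) ms mu mD) //.
- apply: (eq_measure_integral mu) => A mA _.
  exact/esym/lebesgue_measure_shift.
- exact: measurable_funTS.
Qed.

Lemma integral_itv_shift (s : R) (g : R -> \bar R) (a b : R) :
  measurable_fun setT g -> (forall x, 0 <= g x) ->
  \int[mu]_(x in `[a, b]) g (x + s)%R = \int[mu]_(x in `[(a + s)%R, (b + s)%R]) g x.
Proof.
move=> mg g0; rewrite -(integral_shift s (D := `[(a + s)%R, (b + s)%R])) //.
rewrite (_ : _ @^-1` _ = `[a, b]) //.
by apply/seteqP; split => x; rewrite /= !in_itv /=; lra.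
Qed.

Lemma integral_itv_cat (g : R -> \bar R) (a b c : R) :
  measurable_fun setT g -> (forall x, 0 <= g x) -> (a <= b <= c)%R ->
  \int[mu]_(x in `[a, c]) g x =
  \int[mu]_(x in `[a, b]) g x + \int[mu]_(x in `[b, c]) g x.
Proof.
move=> mg g0 /andP[ab bc].
(* Dropping the null point [b] from the second interval makes the two pieces disjoint. *)
rewrite -(@integral_itv_obnd_cbnd R b (BRight c) g); last exact: measurable_funTS.
rewrite -ge0_integral_setU //.
- rewrite -(@itv_bndbnd_setU _ _  (BLeft a) (BRight b) (BRight c)) //.
- exact: measurable_funTS.
- apply/disj_setPS => x [] /=; rewrite !in_itv /= => ? ?; lra.
Qed.

(** The shifted interval [s, 1 + s] is cut at 1, and periodicity moves the piece [1, 1 + s] back to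
    [0, s]. *)
Lemma integral_periodic_shift (s : R) (g : R -> \bar R) :
  measurable_fun setT g -> (forall x, 0 <= g x) ->
  (forall x, g (x + 1)%R = g x) -> (0 <= s <= 1)%R ->
  \int[mu]_(x in `[0%R, 1%R]) g (x + s)%R = \int[mu]_(x in `[0%R, 1%R]) g x.
Proof.
move=> mg g0 g1 s01; rewrite integral_itv_shift // add0r.
rewrite (@integral_itv_cat g s 1) //; last lra.
rewrite [X in _ + X](_ : _ = \int[mu]_(x in `[0%R, s]) g x).
  by rewrite addeC -integral_itv_cat.
have := integral_itv_shift 1%R 0%R s mg g0; rewrite add0r addrC => <-.
by apply: eq_integral => x _.
Qed.

End LebesgueShift.

(** * Measurability, monotonicity, additivity and translation invariance of the iterated integral *)

Section CubeInt.
Variable R : realType.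
Local Open Scope classical_set_scope.
Local Open Scope ereal_scope.

Lemma cube_int_ge0 m (g : m.-tuple R -> \bar R) :
  (forall t, 0 <= g t) -> 0 <= cube_int g.
Proof.
elim: m g => [|m IH] g g0 /=; first exact: g0.
by apply: integral_ge0 => x _; apply: IH.
Qed.

(** The parameter space is arbitrary so that the induction can move the first coordinate into it;
    Tonelli then handles the one integral left. *)
Lemma measurable_cube_int_param m d (T : measurableType d)
    (g : T * m.-tuple R -> \bar R) :
  measurable_fun setT g -> (forall p, 0 <= g p) ->
  measurable_fun setT (fun p => cube_int (fun t => g (p, t))).
Proof.
elim: m d T g => [|m IH] d T g mg g0 /=.
  by apply: measurableT_comp => //; exact: measurable_fun_pair.
pose h (q : T * R) := cube_int (fun t => g (q.1, [tuple of q.2 :: t])).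
have mh : measurable_fun setT h.
  apply: (IH _ _ (fun q => g (q.1.1, [tuple of q.1.2 :: q.2]))) => [|q]; last exact: g0.
  apply: measurableT_comp => //; apply: measurable_fun_pair.
    exact: measurableT_comp.
  by apply: measurable_cons => //; exact: measurableT_comp.
have h0 q : 0 <= h q by apply: cube_int_ge0.
(* [fubini_F] integrates over the whole line, hence the cut-off outside [0, 1]. *)
pose hI := h \_ (setT `*` (`[0%R, 1%R] : set R)).
have mhI : measurable_fun setT hI.
  apply/(measurable_restrictT _ _).1 => //.
    exact: measurableX.
  exact: measurable_funTS.
have hI0 q : 0 <= hI q by apply: erestrict_ge0.
apply: (eq_measurable_fun (fubini_F (@lebesgue_measure R) hI)); last first.
  exact: measurable_fun_fubini_tonelli_F.
move=> p _; rewrite /fubini_F [RHS]integral_mkcond; apply: eq_integral => x _.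
by rewrite /hI !patchE in_setX in_setT.
Qed.

Lemma measurable_cube_int_slice m (g : m.+1.-tuple R -> \bar R) :
  measurable_fun setT g -> (forall t, 0 <= g t) ->
  measurable_fun setT (fun x : R => cube_int (fun t => g [tuple of x :: t])).
Proof.
move=> mg g0.
apply: (measurable_cube_int_param (g := fun q => g [tuple of q.1 :: q.2]))
  => [|q]; last exact: g0.
by apply: measurableT_comp => //; exact: measurable_cons.
Qed.

Lemma measurable_slice m (g : m.+1.-tuple R -> \bar R) (x : R) :
  measurable_fun setT g ->
  measurable_fun setT (fun t : m.-tuple R => g [tuple of x :: t]).
Proof. by move=> mg; apply: measurableT_comp => //; exact: measurable_cons. Qed.

Lemma le_cube_int m (g h : m.-tuple R -> \bar R) :
  measurable_fun setT g -> measurable_fun setT h ->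
  (forall t, 0 <= g t) -> (forall t, g t <= h t) -> cube_int g <= cube_int h.
Proof.
elim: m g h => [|m IH] g h mg mh g0 gh /=; first exact: gh.
have h0 t : 0 <= h t by exact: le_trans (gh t).
apply: ge0_le_integral => //.
- by move=> x _; apply: cube_int_ge0.
- by apply: measurable_funTS; apply: measurable_cube_int_slice.
- by apply: measurable_funTS; apply: measurable_cube_int_slice.
- by move=> x _; apply: IH => //; exact: measurable_slice.
Qed.

Lemma cube_intD m (g h : m.-tuple R -> \bar R) :
  measurable_fun setT g -> measurable_fun setT h ->
  (forall t, 0 <= g t) -> (forall t, 0 <= h t) ->
  cube_int (fun t => g t + h t) = cube_int g + cube_int h.
Proof.
elim: m g h => [//|m IH] g h mg mh g0 h0 /=.
rewrite -ge0_integralD //.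
- by apply: eq_integral => x _; apply: IH => //; exact: measurable_slice.
- by move=> x _; apply: cube_int_ge0.
- by apply: measurable_funTS; apply: measurable_cube_int_slice.
- by move=> x _; apply: cube_int_ge0.
- by apply: measurable_funTS; apply: measurable_cube_int_slice.
Qed.

Lemma cube_int_cst m (a : R) : cube_int (fun _ : m.-tuple R => a%:E) = a%:E.
Proof.
elim: m => [//|m IH] /=.
under eq_integral do rewrite IH.
by rewrite integral_cst //= lebesgue_measure_itv /= lte_fin ltr01 oppr0 adde0 mule1.
Qed.

Lemma cube_int_sum m (I : Type) (s : seq I) (g : I -> m.-tuple R -> \bar R) :
  (forall i, measurable_fun setT (g i)) -> (forall i t, 0 <= g i t) ->
  cube_int (fun t => \sum_(i <- s) g i t) = \sum_(i <- s) cube_int (g i).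
Proof.
move=> mg g0; elim: s => [|i s IH].
  rewrite big_nil -[RHS](cube_int_cst m 0); congr cube_int.
  by apply/funext => t; rewrite big_nil.
rewrite big_cons -IH -cube_intD //.
- by congr cube_int; apply/funext => t; rewrite big_cons.
- exact: emeasurable_sum.
- by move=> t; apply: sume_ge0.
Qed.

Lemma torus_pt_cons m (x : R) (t : m.-tuple R) :
  torus_pt [tuple of x :: t] = [tuple of circ_pt x :: torus_pt t].
Proof. exact: val_inj. Qed.

(** The integrand sees the angles only through [torus_pt], hence has period 1 in each. Induction
    removes the shifts of the inner coordinates, and [integral_periodic_shift] removes that of the
    first. *)
Lemma cube_int_shift m (s : m.-tuple R) (h : m.-tuple R[i] -> \bar R) :
  measurable_fun setT (fun t : m.-tuple R => h (torus_pt t)) -> (forall z, 0 <= h z) ->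
  (forall i, 0 <= tnth s i <= 1)%R ->
  cube_int (fun t => h (torus_pt [tuple tnth t i + tnth s i | i < m]%R)) =
  cube_int (fun t => h (torus_pt t)).
Proof.
elim: m s h => [|m IH] s h mh h0 s01 /=.
  by congr h; apply: eq_from_tnth => -[].
pose G (x : R) := cube_int (fun t => h (torus_pt [tuple of x :: t])).
transitivity (\int[@lebesgue_measure R]_(x in `[0%R, 1%R]) G (x + thead s)%R).
  apply: eq_integral => x _.
  rewrite /G; under [in RHS]eq_fun do rewrite torus_pt_cons.
  rewrite -(IH [tuple of behead s] (fun z => h [tuple of circ_pt (x + thead s) :: z])) //.
  - congr cube_int; apply/funext => t; congr h; apply: eq_from_tnth => i.
    case: (unliftP ord0 i) => [j|] ->.
      rewrite [RHS]tnthS !tnth_map !tnth_ord_tuple tnthS tnth_behead.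
      suff -> : lift ord0 j = inord j.+1 by [].
      by apply: val_inj; rewrite [RHS]inordK ?ltnS ?ltn_ord.
    by rewrite tnth0 !tnth_map !tnth_ord_tuple !tnth0.
  - move: (measurable_slice (x + thead s)%R mh).
    by under eq_fun do rewrite torus_pt_cons.
  - by move=> i; rewrite tnth_behead.
apply: integral_periodic_shift => //.
- exact: (measurable_cube_int_slice mh).
- by move=> x; apply: cube_int_ge0.
- by move=> x; rewrite /G; under eq_fun do
    rewrite torus_pt_cons circ_ptD circ_pt1 mulr1 -torus_pt_cons.
- exact: s01.
Qed.

End CubeInt.

(** * Sign sets and zero set of a Laurent polynomial *)

Section ComplexMeasurable.
Variable R : realType.
Local Open Scope classical_set_scope.

Definition measurable_cfun d (T : measurableType d) (F : T -> R[i]) : Prop :=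
  measurable_fun setT (fun x => complex.Re (F x)) /\
  measurable_fun setT (fun x => complex.Im (F x)).

Section Operations.
Variables (d : measure_display) (T : measurableType d).
Implicit Types F G : T -> R[i].

Lemma measurable_cfun_cst (a : R[i]) : measurable_cfun (fun _ : T => a).
Proof. by split; exact: measurable_cst. Qed.

Lemma measurable_cfunD F G : measurable_cfun F -> measurable_cfun G ->
  measurable_cfun (fun x => F x + G x).
Proof.
move=> [rF iF] [rG iG]; split.
  under eq_fun do rewrite raddfD; exact: measurable_funD.
under eq_fun do rewrite raddfD; exact: measurable_funD.
Qed.

Lemma measurable_cfunM F G : measurable_cfun F -> measurable_cfun G ->
  measurable_cfun (fun x => F x * G x).
Proof.
move=> [rF iF] [rG iG].
have Re_mul (u v : R[i]) : complex.Re (u * v) =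
    complex.Re u * complex.Re v - complex.Im u * complex.Im v.
  by case: u v => [a b] [a' b'].
have Im_mul (u v : R[i]) : complex.Im (u * v) =
    complex.Re u * complex.Im v + complex.Im u * complex.Re v.
  by case: u v => [a b] [a' b'].
split.
  under eq_fun do rewrite Re_mul.
  by apply: measurable_funB; exact: measurable_funM.
under eq_fun do rewrite Im_mul.
by apply: measurable_funD; exact: measurable_funM.
Qed.

Lemma measurable_cfun_sum (I : Type) (s : seq I) (F : I -> T -> R[i]) :
  (forall i, measurable_cfun (F i)) ->
  measurable_cfun (fun x => \sum_(i <- s) F i x).
Proof.
move=> mF; elim: s => [|i s IH].
  by under [fun x => _]eq_fun do rewrite big_nil; exact: measurable_cfun_cst.
under [fun x => _]eq_fun do rewrite big_cons; exact: measurable_cfunD.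
Qed.

Lemma measurable_cfun_prod (I : Type) (s : seq I) (F : I -> T -> R[i]) :
  (forall i, measurable_cfun (F i)) ->
  measurable_cfun (fun x => \prod_(i <- s) F i x).
Proof.
move=> mF; elim: s => [|i s IH].
  by under [fun x => _]eq_fun do rewrite big_nil; exact: measurable_cfun_cst.
under [fun x => _]eq_fun do rewrite big_cons; exact: measurable_cfunM.
Qed.

Lemma measurable_cfun_circ_pt (f : T -> R) : measurable_fun setT f ->
  measurable_cfun (fun x => circ_pt (f x)).
Proof.
move=> mf; have m2 : measurable_fun setT (fun x => 2 * pi * f x).
  by apply: measurable_funM.
split; apply: measurableT_comp m2; apply: continuous_measurable_fun.
  exact: continuous_cos.
exact: continuous_sin.
Qed.

Lemma measurable_Im0 F : measurable_cfun F ->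
  measurable [set x | complex.Im (F x) = 0].
Proof.
move=> [_ iF]; rewrite -[X in measurable X]setTI.
by apply: (iF measurableT [set 0]); exact: measurable_set1.
Qed.

Lemma measurable_cfun_lt0 F : measurable_cfun F -> measurable [set x | F x < 0].
Proof.
move=> mF; have [rF _] := mF.
(* In the order on [R[i]], being negative means having imaginary part 0 and negative real part. *)
rewrite [X in measurable X](_ : _ = [set x | complex.Im (F x) = 0] `&`
    (fun x => complex.Re (F x)) @^-1` `]-oo, 0[ ).
  apply: measurableI; first exact: measurable_Im0.
  by rewrite -[X in measurable X]setTI; apply: rF => //; exact: measurable_itv.
apply/seteqP; split => x /=; rewrite ltcE in_itv /= eq_sym.
  by move=> /andP[/eqP].
by move=> [/eqP -> ->].
Qed.

Lemma measurable_cfun_eq0 F : measurable_cfun F -> measurable [set x | F x = 0].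
Proof.
move=> mF; have [rF _] := mF.
rewrite [X in measurable X](_ : _ = [set x | complex.Im (F x) = 0] `&`
    (fun x => complex.Re (F x)) @^-1` [set 0]).
  apply: measurableI; first exact: measurable_Im0.
  by rewrite -[X in measurable X]setTI; apply: rF => //; exact: measurable_set1.
apply/seteqP; split => x /=; first by move=> ->.
by move=> [i0 r0]; apply/eqP; rewrite eq_complex i0 r0 /= !eqxx.
Qed.

End Operations.

Lemma measurable_laurent m (D : {fset m.-tuple int}) (c : m.-tuple int -> R[i]) :
  measurable_cfun (fun t : m.-tuple R => laurent D c (torus_pt t)).
Proof.
apply: measurable_cfun_sum => d; apply: measurable_cfunM.
  exact: measurable_cfun_cst.
apply: measurable_cfun_prod => i.
under [fun x => _]eq_fun do rewrite tnth_map -circ_ptMz.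
apply: measurable_cfun_circ_pt; apply: measurable_funM => //.
exact: measurable_tnth.
Qed.

Lemma measurable_indic_torus m (A : set (m.-tuple R[i])) :
  measurable [set t : m.-tuple R | A (torus_pt t)] ->
  measurable_fun setT (fun t : m.-tuple R => (\1_A (torus_pt t) : R)%:E).
Proof.
move=> mA; apply/measurable_EFinP.
exact: (measurable_indic (D := setT) (U := [set t : m.-tuple R | A (torus_pt t)])).
Qed.

End ComplexMeasurable.

(** * The zero set of a non-zero Laurent polynomial is null *)

Section ZeroSet.
Variable R : realType.

(** Multiplying by a power of the variable gives a polynomial [q]. Since [e] is injective on [P],
    nothing cancels the coefficient [a d0], so [q] is not zero and has finitely many roots. *)
Lemma finite_laurent1_root (T : choiceType) (D : {fset T}) (P : pred T)
    (e : T -> int) (a : T -> R[i]) (d0 : T) :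
  {in [pred d | P d] &, injective e} -> d0 \in D -> P d0 -> a d0 != 0 ->
  finite_set [set x : R | 0 <= x <= 1 /\
    \sum_(d <- D | P d) a d * circ_pt x ^ e d = 0]%classic.
Proof.
(* [N] is large enough to make every exponent e d + N with d in [D] non-negative. *)
move=> einj d0D Pd0 ad0; pose N := (\sum_(d <- D) absz (e d))%N.
pose q : {poly R[i]} := \sum_(d <- D | P d) a d *: 'X^(absz (e d + N%:Z)).
have eN d : d \in D -> (absz (e d + N%:Z))%:Z = e d + N%:Z.
  move=> dD; apply: gez0_abs; rewrite addrC -[e d]opprK subr_ge0.
  apply: le_trans (ler_norm _) _.
  by rewrite normrN -abszE lez_nat /N (big_rem d) //= leq_addr.
have q0 : q != 0.
  apply: contraNneq ad0 => /(congr1 (fun r : {poly R[i]} => r`_(absz (e d0 + N%:Z)))).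
  rewrite coef0 coef_sum big_mkcond (bigD1_seq d0) //= Pd0.
  rewrite coefZ coefXn eqxx mulr1 big_seq_cond big1 ?addr0 => [->//|d /andP[dD dd0]].
  case: ifP => // Pd; rewrite coefZ coefXn.
  case: eqP => [/(congr1 Posz)|]; last by rewrite mulr0.
  by rewrite !eN // => /addIr /einj dE; rewrite dE ?eqxx // in dd0.
apply: sub_finite_set (finite_circ_pt_root q0) => x [x01 px0]; split => //.
apply/rootP; rewrite horner_sum.
transitivity (circ_pt x ^ N%:Z * \sum_(d <- D | P d) a d * circ_pt x ^ e d).
  rewrite mulr_sumr big_seq_cond [RHS]big_seq_cond.
  apply: eq_bigr => d /andP[dD _].
  rewrite hornerZ hornerXn -[_ ^+ _]/(circ_pt x ^ (absz (e d + N%:Z))%:Z) eN //.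
  by rewrite mulrCA -expfzDr ?circ_pt_neq0 // addrC.
by rewrite px0 mulr0.
Qed.

Definition ttail m (d : m.+1.-tuple int) : m.-tuple int := [tuple of behead d].

Definition tail_support m (D : {fset m.+1.-tuple int}) : {fset m.-tuple int} :=
  [fset ttail d | d in D]%fset.

(** The coefficient of w^e in f(z, w), itself a Laurent polynomial in the first variable z. *)
Definition tail_coef m (D : {fset m.+1.-tuple int}) (c : m.+1.-tuple int -> R[i])
    (z : R[i]) (e : m.-tuple int) : R[i] :=
  \sum_(d <- D | ttail d == e) c d * z ^ thead d.

Lemma laurent_cons m (D : {fset m.+1.-tuple int}) c (z : R[i]) (w : m.-tuple R[i]) :
  laurent D c [tuple of z :: w] = laurent (tail_support D) (tail_coef D c z) w.
Proof.
rewrite /laurent (partition_big_imfset _ (@ttail m)) /=.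
apply: eq_bigr => e _; rewrite mulr_suml; apply: eq_bigr => d /eqP <-.
rewrite big_ord_recl tnth0 mulrA; congr (_ * _); apply: eq_bigr => i _.
rewrite tnthS tnth_behead; congr (_ ^ tnth d _).
by apply: val_inj; rewrite [RHS]inordK ?ltnS ?ltn_ord.
Qed.

(** Induction on m. The coefficient at the tail [e0] of [d0] vanishes for only finitely many first
    angles; for every other one the slice is a non-zero Laurent polynomial in m variables, whose
    zero set is null by induction. *)
Lemma cube_int_laurent_zero m (D : {fset m.-tuple int}) (c : m.-tuple int -> R[i]) :
  (exists2 d, d \in D & c d != 0) ->
  cube_int (fun t : m.-tuple R =>
    (\1_[set z | laurent D c z = 0]%classic (torus_pt t) : R)%:E) = 0%E.
Proof.
elim: m D c => [|m IH] D c [d0 d0D cd0] /=.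
  rewrite indicE memNset //= /laurent (bigD1_seq d0) //=.
  rewrite [X in _ + X]big1 => [|d]; last first.
    by case/negP; apply/eqP; rewrite (tuple0 d) (tuple0 d0).
  by rewrite big_ord0 mulr1 addr0; exact/eqP.
pose e0 := ttail d0.
pose B := [set x : R | 0 <= x <= 1 /\ tail_coef D c (circ_pt x) e0 = 0]%classic.
have finB : finite_set B.
  apply: (finite_laurent1_root (d0 := d0)) => //.
  move=> d d' /eqP de /eqP d'e hd.
  (* Among exponents with the same tail, the head determines the exponent. *)
  have eta (t : m.+1.-tuple int) : t = [tuple of thead t :: ttail t].
    by rewrite [LHS]tuple_eta; exact: val_inj.
  by rewrite (eta d) (eta d') hd de d'e.
have mB : measurable (B : set (measurableTypeR R)).
  exact/countable_measurable/finite_set_countable.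
set g := fun t : m.+1.-tuple R =>
  (\1_[set z | laurent D c z = 0]%classic (torus_pt t) : R)%:E.
have mg : measurable_fun setT g.
  apply: measurable_indic_torus; exact: (measurable_cfun_eq0 (measurable_laurent D c)).
have g0 t : (0 <= g t)%E by rewrite lee_fin indicE ler0n.
rewrite -(integral0 (@lebesgue_measure R) `[0, 1]%classic).
apply: ae_eq_integral => //.
  by apply: measurable_funTS; exact: (measurable_cube_int_slice mg).
exists B; split => //; first exact/countable_lebesgue_measure0/finite_set_countable.
move=> x /= /not_implyP[]; rewrite in_itv /= => x01 nz.
split => //; apply: contra_notP nz => cx.
rewrite -(IH (tail_support D) (tail_coef D c (circ_pt x))).
  by congr cube_int; apply/funext => t; rewrite /g torus_pt_cons !indicE;
    congr ((nat_of_bool _)%:R%:E); apply/idP/idP; rewrite !inE /= laurent_cons.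
exists e0; first exact: in_imfset.
exact/eqP.
Qed.

End ZeroSet.

(** * Averaging the inertia bound over the torus *)

Section SignMeasure.
Variables (R : realType) (m : nat) (D : {fset m.-tuple int}).
Variable c : m.-tuple int -> R[i].
Local Open Scope classical_set_scope.

Lemma torus_torus_pt (t : m.-tuple R) : torus (torus_pt t).
Proof. by move=> i; rewrite tnth_map normr_circ_pt. Qed.

Lemma laurentN (z : m.-tuple R[i]) : laurent D (fun d => - c d) z = - laurent D c z.
Proof. by rewrite /laurent -sumrN; apply: eq_bigr => d _; rewrite mulNr. Qed.

Lemma rho_minusE : rho_minus (laurent D c) = rho_plus (laurent D (fun d => - c d)).
Proof.
congr haar_torus; apply/seteqP.
by split => z /= [tz]; rewrite laurentN oppr_gt0.
Qed.

Lemma indic_measurable_rho_plus :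
  measurable_fun setT (fun t : m.-tuple R =>
    (\1_[set z | torus z /\ 0 < laurent D c z] (torus_pt t) : R)%:E).
Proof.
apply: measurable_indic_torus => /=.
rewrite [X in measurable X](_ : _ =
    [set t : m.-tuple R | laurent D (fun d => - c d) (torus_pt t) < 0]).
  exact/measurable_cfun_lt0/measurable_laurent.
apply/seteqP; split => t /=; rewrite laurentN oppr_lt0; first by case.
by split => //; exact: torus_torus_pt.
Qed.

Lemma rho_plus_ge0 : (0 <= rho_plus (laurent D c))%E.
Proof. by apply: cube_int_ge0 => t; rewrite lee_fin indicE ler0n. Qed.

Lemma rho_plus_le1 : (rho_plus (laurent D c) <= 1)%E.
Proof.
rewrite -(cube_int_cst m (1 : R)); apply: le_cube_int => //.
- exact: indic_measurable_rho_plus.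
- by move=> t; rewrite lee_fin indicE lern1 leq_b1.
Qed.

Hypothesis Dsym : forall d, d \in D -> zvecN d \in D.
Hypothesis hc : forall d, d \in D -> c (zvecN d) = (c d)^*.

(** Conjugation on the torus exchanges the terms of d and -d, and D = -D makes this a permutation of
    the sum. *)
Lemma conj_laurent (t : m.-tuple R) :
  (laurent D c (torus_pt t))^* = laurent D c (torus_pt t).
Proof.
have zvecNK : involutive (@zvecN m).
  by move=> d; apply: eq_from_tnth => i; rewrite !tnth_map opprK.
rewrite /laurent rmorph_sum /=.
rewrite [RHS](perm_big [seq zvecN d | d <- D]) /=; last first.
  apply: uniq_perm => [||d]; first exact: fset_uniq.
    by rewrite map_inj_uniq ?fset_uniq //; exact: inv_inj.
  apply/idP/mapP => [dD|[e eD ->]]; last exact: Dsym.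
  by exists (zvecN d); rewrite ?zvecNK //; exact: Dsym.
rewrite big_map big_seq [RHS]big_seq; apply: eq_bigr => d dD.
rewrite hc // rmorphM rmorph_prod /=; congr (_ * _); apply: eq_bigr => i _.
by rewrite !tnth_map -!circ_ptMz conj_circ_pt mulrNz mulrN.
Qed.

Hypothesis hf : exists2 d, d \in D & c d != 0.

(** The non-negative set is covered by the positive set and the zero set, and the latter is null. *)
Lemma haar_laurent_ge0 :
  (cube_int (fun t : m.-tuple R =>
     (\1_[set z | ~ (laurent D c z < 0)] (torus_pt t) : R)%:E) <=
   rho_plus (laurent D c))%E.
Proof.
rewrite -[leRHS]adde0 -(cube_int_laurent_zero hf) -cube_intD.
- apply: le_cube_int.
  + apply: measurable_indic_torus.
    exact: (measurableC (measurable_cfun_lt0 (measurable_laurent D c))).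
  + apply: emeasurable_funD; first exact: indic_measurable_rho_plus.
    apply: measurable_indic_torus.
    exact: (measurable_cfun_eq0 (measurable_laurent D c)).
  + by move=> t; rewrite lee_fin indicE ler0n.
  + move=> t; rewrite -EFinD lee_fin !indicE.
    have [|_] := boolP (_ \in [set z | ~ (laurent D c z < 0)]); last first.
      by rewrite addr_ge0 ?ler0n.
    rewrite inE /= => nlt0.
    (* The order on [R[i]] is partial: only for a real value does not negative mean zero or
       positive. *)
    have rf : laurent D c (torus_pt t) \is Num.real by apply/CrealP; exact: conj_laurent.
    move: rf; rewrite realE => /orP[]; rewrite le_eqVlt => /orP[/eqP f0|]//.
    + rewrite [X in _ + (nat_of_bool X)%:R]mem_set /=; last by rewrite -f0.
      by rewrite lerDr ler0n.
    + move=> fpos; rewrite [X in (nat_of_bool X)%:R + _]mem_set /=.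
        by rewrite lerDl ler0n.
      by split => //; exact: torus_torus_pt.
    + rewrite [X in _ + (nat_of_bool X)%:R]mem_set /=; last by rewrite f0.
      by rewrite lerDr ler0n.
- exact: indic_measurable_rho_plus.
- apply: measurable_indic_torus.
  exact: (measurable_cfun_eq0 (measurable_laurent D c)).
- by move=> t; rewrite lee_fin indicE ler0n.
- by move=> t; rewrite lee_fin indicE ler0n.
Qed.

(* The inertia bound holds on every grid t + k/n; by translation invariance,
   integrating over t turns the number of nodes into n^m times the measure. *)
Lemma alpha_circ_le n : (0 < n)%N ->
  ((alpha_circ n D)%:R%:E <= (n%:R ^+ m)%:E * rho_plus (laurent D c))%E.
Proof.
move=> n_gt0.
have [S indS ->] : exists2 S : {set m.-tuple 'I_n},
    circ_indep D S & alpha_circ n D = #|S|.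
  have i0 : circ_indep D (finset.set0 : {set m.-tuple 'I_n}).
    by apply/forallP => u; rewrite inE.
  have [|S /= iS eS] := @eq_bigmax_cond _ [pred S | circ_indep D S]
    (fun S : {set m.-tuple 'I_n} => #|S|).
    by apply/card_gt0P; exists finset.set0.
  by exists S.
pose neg := [set z : m.-tuple R[i] | ~ (laurent D c z < 0)].
have mneg : measurable_fun setT (fun t : m.-tuple R => (\1_neg (torus_pt t) : R)%:E).
  apply: measurable_indic_torus.
  exact: (measurableC (measurable_cfun_lt0 (measurable_laurent D c))).
(* The node of index k is the translate of t by [s k], whose coordinates lie in [0, 1] as
   [cube_int_shift] requires. *)
pose s k : m.-tuple R := [tuple (tnth k i : 'I_n)%:R / n%:R | i < m].
have nodeE k t : node t k = [tuple tnth t i + tnth (s k) i | i < m].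
  by apply: eq_from_tnth => i; rewrite !tnth_mktuple.
have mnode (k : m.-tuple 'I_n) : measurable_fun setT
    (fun t : m.-tuple R => (\1_neg (torus_pt (node t k)) : R)%:E).
  apply: (measurableT_comp mneg); apply/measurable_fun_tnthP => i.
  rewrite (_ : _ \o _ = (fun t : m.-tuple R => tnth t i + tnth (s k) i)).
    by apply: measurable_funD => //; exact: measurable_tnth.
  by apply/funext => t /=; rewrite nodeE tnth_mktuple.
have ind0 (A : set (m.-tuple R[i])) z : (0 <= (\1_A z : R)%:E)%E.
  by rewrite lee_fin indicE ler0n.
(* The inertia bound as a pointwise inequality in t, with constant left side. *)
have card_le t : ((#|S|%:R : R)%:E <=
    \sum_(k : m.-tuple 'I_n) (\1_neg (torus_pt (node t k)) : R)%:E)%E.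
  rewrite sumEFin lee_fin; under eq_bigr do rewrite indicE.
  rewrite -natr_sum ler_nat; apply: leq_trans (indep_inertia n_gt0 c t indS) _.
  rewrite -sum1_card big_mkcond /=; apply: leq_sum => k _.
  rewrite inE; case: ifPn => // fk; rewrite mem_set //.
  exact/negP.
rewrite -(cube_int_cst m).
apply: le_trans (le_cube_int _ _ _ card_le) _ => //.
- exact: emeasurable_sum.
- rewrite cube_int_sum //.
  rewrite (eq_bigr (fun=> cube_int (fun t : m.-tuple R => (\1_neg (torus_pt t) : R)%:E))).
    rewrite (etrans (sumr_const _ _) (esym (mule_natl _ _))).
    rewrite card_tuple card_ord natrX.
    by apply: lee_wpmul2l; [rewrite lee_fin exprn_ge0 | exact: haar_laurent_ge0].
  move=> k _; under [in LHS]eq_fun do rewrite nodeE.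
  apply: (cube_int_shift (h := fun z => (\1_neg z : R)%:E)) => // i.
  rewrite tnth_mktuple divr_ge0 //= ler_pdivrMr ?ltr0n // mul1r ler_nat.
  exact: ltnW.
Qed.

End SignMeasure.

(** The bound of [alpha_circ_le], divided by n^m, has a right side independent of n, so it passes to
    the limit. *)
Lemma alphaD_le_rho_plus (R : realType) (m : nat) (D : {fset m.-tuple int})
  (Dsym : forall d, d \in D -> zvecN d \in D) (c : m.-tuple int -> R[i])
  (hc : forall d, d \in D -> c (zvecN d) = (c d)^*)
  (hf : exists2 d, d \in D & c d != 0) :
  ((alphaD R D)%:E <= rho_plus (laurent D c))%E.
Proof.
have rho0 := rho_plus_ge0 D c; have rho1 := rho_plus_le1 D c.
have rho_fin : (rho_plus (laurent D c) \is a fin_num)%E.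
  by rewrite ge0_fin_numE // (le_lt_trans rho1) // ltry.
have := @alpha_circ_le R m D c Dsym hc hf.
rewrite -(fineK rho_fin) in rho0 *; set r := fine _ => bound.
rewrite lee_fin /alphaD.
have [cv|/dvgP ->] := pselect (cvgn (fun n : nat =>
    (alpha_circ n D)%:R / (n%:R ^+ m) : R)).
  apply: limr_le => //; exists 1%N => // n /= n_gt0.
  have := bound n n_gt0; rewrite -EFinM lee_fin => bn.
  by rewrite ler_pdivrMr ?exprn_gt0 ?ltr0n // mulrC.
(* a divergent sequence has the junk limit [point], which is 0 *)
by rewrite -lee_fin.
Qed.

Theorem theorem7 (R : realType) (m : nat) (D : {fset m.-tuple int})
  (D0 : zvec0 m \notin D)
  (Dsym : forall d, d \in D -> zvecN d \in D)
  (c : m.-tuple int -> R[i])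
  (hc : forall d, d \in D -> c (zvecN d) = (c d)^*)
  (hf : exists2 d, d \in D & c d != 0) :
  ((alphaD R D)%:E <= Order.min (rho_plus (laurent D c))
                                (rho_minus (laurent D c)))%E.
Proof.
rewrite le_min; apply/andP; split; first exact: alphaD_le_rho_plus.
(* The coefficients of -f satisfy the same symmetry and are not all zero. *)
rewrite rho_minusE; apply: alphaD_le_rho_plus => //.
  by move=> d dD; rewrite hc // rmorphN.
by have [d dD cd] := hf; exists d => //; rewrite oppr_eq0.
Qed.
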